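(* Let $N\ge 1$ and $d\ge 1$ be integers. Let $S_F$ denote the set of functions $f\in C(\mathbb{R}^d,\mathbb{R})$ which satisfy $$\Delta_h^N f(x)=\sum_{k=0}^N\binom{N}{k}(-1)^{N-k}f(x+kh)=0\quad\text{for all } x,h\in\mathbb{R}^d$$ (or, equivalently, which satisfy $\Delta_{h_1h_2\cdots h_N}f(x)=0$ for all $x,h_1,h_2,\dots,h_N\in\mathbb{R}^d$). Then $$S_F=\Pi_{N-1}^d.$$
   Context: $C(\mathbb{R}^d,\mathbb{R})$ denotes the space of continuous functions $f:\mathbb{R}^d\to\mathbb{R}$. For $h\in\mathbb{R}^d$, $\Delta_h f(x)=f(x+h)-f(x)$, and $\Delta_h^N$ is its $N$-th iterate. For $h_1,\dots,h_s\in\mathbb{R}^d$, $\Delta_{h_1h_2\cdots h_s}f(x)=\Delta_{h_1}(\Delta_{h_2\cdots h_s}f)(x)$ for $s=2,3,\dots$. $\Pi_m^d$ denotes the set of real polynomials in $d$ real variables with total degree $\leq m$ (viewed as functions on $\mathbb{R}^d$). *)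

(* Defs.v *)
From HB Require Import structures.
From mathcomp Require Import all_boot all_order all_algebra.
From mathcomp Require Import all_classical all_reals all_analysis.
(* The notations of [mpoly] clash with those of MathComp-Analysis. *)
From mathcomp Require Import -(notations) mpoly.
Import Order.TTheory GRing.Theory Num.Theory.
Import numFieldNormedType.Exports.

Set Implicit Arguments.
Unset Strict Implicit.
Unset Printing Implicit Defensive.

Local Open Scope classical_set_scope.
Local Open Scope ring_scope.

Definition fdiff (R : realType) (d : nat) (h : 'rV[R]_d) (f : 'rV[R]_d -> R) :
    'rV[R]_d -> R :=
  fun x => f (x + h) - f x.

Definition fdiff_iter (R : realType) (d N : nat) (h : 'rV[R]_d)
    (f : 'rV[R]_d -> R) : 'rV[R]_d -> R :=
  iter N (fdiff h) f.

(* On [:: h_1; ...; h_s] the head is the outermost difference: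
   fdiff h_1 (fdiff h_2 (... (fdiff h_s f))). *)
Definition fdiff_mixed (R : realType) (d : nat) (hs : seq 'rV[R]_d)
    (f : 'rV[R]_d -> R) : 'rV[R]_d -> R :=
  foldr (@fdiff R d) f hs.

Definition frechet_sol (R : realType) (d N : nat) : set ('rV[R]_d -> R) :=
  [set f | continuous f /\ forall x h : 'rV[R]_d, fdiff_iter N h f x = 0].

Definition frechet_mixed_sol (R : realType) (d N : nat) :
    set ('rV[R]_d -> R) :=
  [set f | continuous f /\
     forall (x : 'rV[R]_d) (hs : N.-tuple 'rV[R]_d), fdiff_mixed hs f x = 0].

(* [msize p] is the total degree of [p] plus one, and 0 for p = 0. *)
Definition polyfun (R : realType) (d m : nat) : set ('rV[R]_d -> R) :=
  [set f | exists p : mpoly.mpoly d R,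
     (mpoly.msize p <= m.+1)%N /\
     f = fun x : 'rV[R]_d => mpoly.meval (fun i => x ord0 i) p].

Arguments frechet_sol : clear implicits.
Arguments frechet_mixed_sol : clear implicits.
Arguments polyfun : clear implicits.

(* Main.v *)
Require Import Defs.
From mathcomp Require Import all_boot all_order all_algebra qpoly.
From mathcomp Require Import all_classical all_reals all_analysis.
From mathcomp Require Import -(notations) mpoly.
From mathcomp Require Import ring.
Import Order.TTheory GRing.Theory Num.Theory.
Import numFieldNormedType.Exports.

Set Implicit Arguments.
Unset Strict Implicit.
Unset Printing Implicit Defensive.

Local Open Scope classical_set_scope.
Local Open Scope ring_scope.

(** Everything follows from a cycle of inclusions: polynomials of degree less
    than [N] are killed by every mixed difference of order [N]; taking all
    steps equal, such functions satisfy Fréchet's equation; and a continuous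
    solution of Fréchet's equation is a polynomial of degree less than [N].

    For the first inclusion, multiplying a function by a coordinate raises by
    at most one the order of the differences that annihilate it, by the
    discrete Leibniz rule ([mixed_null_mul_coord]); so a monomial of degree
    [k] is annihilated in order [k + 1].

    The last inclusion starts in one variable.  On an arithmetic progression
    Fréchet's equation is a linear recurrence of order [N], so the solution is
    determined there by its first [N] values and coincides with the polynomial
    interpolating them ([poly_on_progression]).  Any rational lies on a
    progression that also contains all natural numbers, which forces the
    interpolating polynomials of all these progressions to be the same one;
    continuity extends the equality from the rationals to the reals
    ([continuous_fdiff_eq0_poly]).

    In several variables the restriction of the solution to each line is
    therefore a polynomial of degree less than [N].  Lagrange interpolation in
    one coordinate after the other shows that the solution is a polynomial
    ([poly_on_lines_mpoly]).  Its total degree is controlled by restricting it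
    to the lines through the origin: the coefficient of [t ^ k] in
    [f (t *: x)] is the homogeneous component of degree [k] at [x], so these
    components vanish for [k >= N] ([poly_on_lines_polyfun]). *)

(** * The binomial formula for iterated differences *)

Lemma fdiff_iterE (R : realType) (d N : nat) (f : 'rV[R]_d -> R)
    (x h : 'rV[R]_d) :
  fdiff_iter N h f x =
  \sum_(0 <= k < N.+1) 'C(N, k)%:R * (-1) ^+ (N - k) * f (x + h *+ k).
Proof.
elim: N x => [|N IH] x.
  by rewrite big_nat1 bin0 subnn expr0 mulr0n addr0 !mul1r.
rewrite /fdiff_iter iterS -/(fdiff_iter N h f) /fdiff !IH.
rewrite [RHS]big_nat_recl // [X in _ = _ + X](eq_bigr (fun k =>
   'C(N, k)%:R * (-1) ^+ (N - k) * f (x + h + h *+ k)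
   + 'C(N, k.+1)%:R * (-1) ^+ (N - k) * f (x + h *+ k.+1))); last first.
  by move=> k _; rewrite binS natrD subSS mulrS addrA; ring.
rewrite big_split /= addrCA; congr (_ + _).
rewrite [in RHS]big_nat_recr //= (@bin_small N N.+1) // !mul0r.
rewrite big_nat_recl // opprD !bin0 !subn0 mulr0n !addr0 exprS.
congr (_ + _); first by ring.
rewrite -sumrN; apply: eq_big_nat => k /andP[_ kN].
by rewrite -[in RHS](subnSK kN) exprS; ring.
Qed.

Lemma fdiff_mixed_nseq (R : realType) (d n : nat) (h : 'rV[R]_d)
    (f : 'rV[R]_d -> R) :
  fdiff_mixed (nseq n h) f = fdiff_iter n h f.
Proof. by rewrite /fdiff_mixed /fdiff_iter; elim: n => //= n ->. Qed.

(** * Polynomials are annihilated by mixed differences *)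

Definition mixed_null (R : realType) (d n : nat) (f : 'rV[R]_d -> R) : Prop :=
  forall hs : seq 'rV[R]_d, size hs = n -> fdiff_mixed hs f = fun=> 0.

Section MixedNull.
Variables (R : realType) (d : nat).
Implicit Types (f g : 'rV[R]_d -> R) (a h : 'rV[R]_d).

(** Peels off the innermost difference, whereas [fdiff_mixed] is defined by
    adding an outermost one; the inductions below apply the Leibniz rule to
    [fdiff h f] and thus need this form. *)
Lemma mixed_nullS n f :
  mixed_null n.+1 f <-> forall h, mixed_null n (fdiff h f).
Proof.
split=> [nf h hs hsn|nf hs].
  by rewrite -(nf (rcons hs h)) ?size_rcons ?hsn // /fdiff_mixed foldr_rcons.
case/lastP: hs => [//|hs h]; rewrite size_rcons => -[hsn].
by rewrite -(nf h hs hsn) /fdiff_mixed foldr_rcons.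
Qed.

Lemma mixed_null_zero n : mixed_null n (fun _ : 'rV[R]_d => 0).
Proof.
elim: n => [|n IH]; first by case.
apply/mixed_nullS => h; rewrite (_ : fdiff h _ = fun=> 0) //.
by apply/funext => x; rewrite /fdiff subrr.
Qed.

Lemma mixed_null_widen m n f :
  (m <= n)%N -> mixed_null m f -> mixed_null n f.
Proof.
move=> /subnKC <-; move: (n - m)%N => k.
elim: k m f => [|k IH] m f nf; first by rewrite addn0.
rewrite addnS -addSn; apply: IH; elim: m f nf => [|m IH] f nf.
  by have /= -> := nf [::] erefl; exact: mixed_null_zero.
by apply/mixed_nullS => h; apply: IH; move: h; apply/mixed_nullS.
Qed.

Lemma mixed_null_comb n c f g : mixed_null n f -> mixed_null n g ->
  mixed_null n (fun x => c * f x + g x).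
Proof.
elim: n f g => [|n IH] f g nf ng.
  have /= -> := nf [::] erefl; have /= -> := ng [::] erefl.
  by rewrite mulr0 addr0; exact: mixed_null_zero.
apply/mixed_nullS => h.
rewrite (_ : fdiff h _ = fun x => c * fdiff h f x + fdiff h g x).
  by apply: IH; move: h; apply/mixed_nullS.
by apply/funext => x; rewrite /fdiff; ring.
Qed.

Lemma mixed_null_sum n (I : Type) (r : seq I) (c : I -> R)
    (F : I -> 'rV[R]_d -> R) (P : pred I) :
  (forall i, P i -> mixed_null n (F i)) ->
  mixed_null n (fun x => \sum_(i <- r | P i) c i * F i x).
Proof.
move=> nF; elim: r => [|i r IH].
  by under eq_fun do rewrite big_nil; exact: mixed_null_zero.
case Pi: (P i); under eq_fun do rewrite big_cons Pi.
  exact: mixed_null_comb (nF i Pi) IH.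
exact: IH.
Qed.

Lemma mixed_null_shift n a f :
  mixed_null n f -> mixed_null n (fun x => f (x + a)).
Proof.
elim: n f => [|n IH] f nf.
  by have /= -> := nf [::] erefl; exact: mixed_null_zero.
apply/mixed_nullS => h.
rewrite (_ : fdiff h _ = fun x => fdiff h f (x + a)).
  by apply: IH; move: h; apply/mixed_nullS.
by apply/funext => x; rewrite /fdiff addrAC.
Qed.

(** By the Leibniz rule, the difference of [x_i * f x] in direction [h] is
    [x_i * fdiff h f x + h_i * f (x + h)]: in the first term [f] has lost one
    order, in the second one the factor [x_i] has disappeared. *)
Lemma mixed_null_mul_coord n (i : 'I_d) f :
  mixed_null n f -> mixed_null n.+1 (fun x => x ord0 i * f x).
Proof.
elim: n f => [|n IH] f nf.
  have /= -> := nf [::] erefl.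
  under eq_fun do rewrite mulr0.
  exact: mixed_null_zero.
apply/mixed_nullS => h.
rewrite (_ : fdiff h _ = fun x =>
   h ord0 i * f (x + h) + x ord0 i * fdiff h f x).
  apply: mixed_null_comb; first exact: mixed_null_shift.
  by apply: IH; move: h; apply/mixed_nullS.
by apply/funext => x; rewrite /fdiff mxE; ring.
Qed.

Lemma mixed_null_mul_coordX n k (i : 'I_d) f :
  mixed_null n f -> mixed_null (k + n) (fun x => x ord0 i ^+ k * f x).
Proof.
move=> nf; elim: k => [|k IH].
  by under eq_fun do rewrite expr0 mul1r.
rewrite addSn; under eq_fun do rewrite exprS -mulrA.
exact: mixed_null_mul_coord.
Qed.

Lemma mixed_null_monomial (e : 'I_d -> nat) :
  mixed_null (\sum_i e i).+1 (fun x : 'rV[R]_d => \prod_i x ord0 i ^+ e i).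
Proof.
elim: (index_enum _) => [|i r IH].
  rewrite big_nil; under eq_fun do rewrite big_nil.
  apply/mixed_nullS => h; rewrite (_ : fdiff h _ = fun=> 0).
    exact: mixed_null_zero.
  by apply/funext => x; rewrite /fdiff subrr.
rewrite big_cons; under [X in mixed_null _ X]eq_fun do rewrite big_cons.
by rewrite -addnS; exact: mixed_null_mul_coordX.
Qed.

End MixedNull.

Lemma polyfun_continuous (R : realType) (d m : nat) (f : 'rV[R]_d -> R) :
  polyfun R d m f -> continuous f.
Proof.
case=> p [_ ->]; under eq_fun do rewrite mevalE.
apply: continuous_big => [|e _ x]; first exact: add_continuous.
apply: continuousM; first exact: cst_continuous.
move: x; apply: (@continuous_big R^o _ *%R) => [|i _ x].
  exact: mul_continuous.
apply: (continuous_comp (g := fun t : R => t ^+ e i)).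
  exact: coord_continuous.
exact: exprn_continuous.
Qed.

Lemma polyfun_mixed_null (R : realType) (d m : nat) (f : 'rV[R]_d -> R) :
  polyfun R d m f -> mixed_null m.+1 f.
Proof.
case=> p [pm ->]; under eq_fun do rewrite mevalE big_seq.
apply: mixed_null_sum => e ep.
apply: mixed_null_widen _ (@mixed_null_monomial R d e).
by rewrite -mdegE (leq_trans _ pm) // msize_mdeg_lt.
Qed.

Lemma polyfun_frechet_mixed_sol (R : realType) (d m : nat) :
  polyfun R d m `<=` frechet_mixed_sol R d m.+1.
Proof.
move=> f fp; split; first exact: polyfun_continuous fp.
by move=> x hs; rewrite (polyfun_mixed_null fp) // size_tuple.
Qed.

Lemma frechet_mixed_sol_sub (R : realType) (d N : nat) :
  frechet_mixed_sol R d N `<=` frechet_sol R d N.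
Proof.
move=> f [fc f0]; split=> // x h.
by rewrite -[RHS](f0 x (nseq_tuple N h)) fdiff_mixed_nseq.
Qed.

(** * Fréchet's equation in one variable *)

Section OneVariable.
Variable R : realType.
Implicit Types (p q : {poly R}) (a b t : R) (u : nat -> R) (g : R -> R).

Lemma poly_fdiff_eq0 N p a b : (size p <= N)%N ->
  \sum_(0 <= k < N.+1) 'C(N, k)%:R * (-1) ^+ (N - k) * p.[a + b *+ k] = 0.
Proof.
(* The line is regarded as ['rV_1], where monomials are already treated. *)
move=> pN; pose f (x : 'rV[R]_1) := p.[x ord0 ord0].
have nf : mixed_null N f.
  rewrite /f; under eq_fun do rewrite horner_coef.
  apply: mixed_null_sum => i _.
  have := @mixed_null_monomial R 1 (fun=> i); rewrite big_ord1.
  under [X in mixed_null _ X]eq_fun do rewrite big_ord1.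
  exact/mixed_null_widen/(leq_trans (ltn_ord i)).
have /(congr1 (@^~ (const_mx a))) := nf (nseq N (const_mx b)) (size_nseq _ _).
rewrite fdiff_mixed_nseq fdiff_iterE => f0; rewrite -[RHS]f0.
apply: eq_bigr => k _.
by rewrite /f mxE mxE mulmxnE mxE.
Qed.

(** The coefficient of the top term of the recurrence is 1, so each value is
    determined by the [N] preceding ones. *)
Lemma recurrence_eq0 N u :
  (forall m, \sum_(0 <= k < N.+1)
     'C(N, k)%:R * (-1) ^+ (N - k) * u (m + k)%N = 0) ->
  (forall k, (k < N)%N -> u k = 0) -> forall k, u k = 0.
Proof.
move=> urec u0; elim/ltn_ind => k IH.
have [/u0//|Nk] := ltnP k N.
have := urec (k - N)%N.
rewrite big_nat_recr //= big_nat big1 ?add0r => [|i /andP[_ iN]]; last first.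
  by rewrite IH ?mulr0 // -ltn_subRL subKn.
by rewrite binn subnn expr0 !mul1r subnK.
Qed.

Lemma interpolation N (x : nat -> R) u : injective x ->
  exists p, (size p <= N)%N /\ forall k, (k < N)%N -> p.[x k] = u k.
Proof.
move=> x_inj; have [->|N_gt0] := posnP N; first by exists 0; rewrite size_poly0.
exists (\sum_(i < N) u i *: (tnth (N.-lagrange x) i : {poly R})); split.
  apply: (leq_trans (size_sum _ _ _)); apply/bigmax_leqP => i _.
  by rewrite (leq_trans (size_scale_leq _ _)) // size_lagrange_.
move=> k kN; rewrite horner_sum (bigD1 (Ordinal kN)) //= hornerZ.
rewrite (lagrange_sample N_gt0 x_inj (Ordinal kN) (Ordinal kN)) eqxx mulr1.
rewrite big1 ?addr0 // => i ik; rewrite hornerZ.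
by rewrite (lagrange_sample N_gt0 x_inj i (Ordinal kN)) (negPf ik) mulr0.
Qed.

Lemma poly_eq_on_nat p q : (forall k : nat, p.[k%:R] = q.[k%:R]) -> p = q.
Proof.
move=> pq; apply/eqP; rewrite -subr_eq0; apply: contraT => nz.
pose s := [seq k%:R : R | k <- iota 0 (size (p - q))].
have := @max_poly_roots _ (p - q) s nz.
rewrite size_map size_iota ltnn => -> //.
  by apply/allP => _ /mapP[k _ ->]; rewrite /root hornerD hornerN pq subrr.
by rewrite map_inj_uniq ?iota_uniq // => a b /eqP; rewrite eqr_nat => /eqP.
Qed.

Lemma eq_continuous_rat (f g : R -> R) : continuous f -> continuous g ->
  (forall r : rat, f (ratr r) = g (ratr r)) -> f = g.
Proof.
move=> fc gc fg; apply/funext => t; apply/eqP; rewrite -subr_eq0.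
apply: contraT => nz; pose O := (fun s => f s - g s) @^-1` (~` [set 0 : R]).
have [|s [Or [r _ rE]]] := @dense_rat R O (ex_intro _ t (elimN eqP nz)).
  apply: open_comp => [s _|].
    by apply: continuousB; [exact: fc|exact: gc].
  exact/closed_openC/closed_eq.
by move: Or; rewrite /O /= -rE fg subrr.
Qed.

(** Both [g] and the polynomial interpolating its first [N] values satisfy the
    same linear recurrence of order [N]. *)
Lemma poly_on_progression N g a b : b != 0 ->
  (forall m, \sum_(0 <= k < N.+1)
    'C(N, k)%:R * (-1) ^+ (N - k) * g (a + b *+ m + b *+ k) = 0) ->
  exists p, (size p <= N)%N /\ forall k, g (a + b *+ k) = p.[a + b *+ k].
Proof.
move=> b0 g0; have x_inj : injective (fun k => a + b *+ k).
  move=> i j /addrI /eqP; rewrite -[b *+ i]mulr_natr -[b *+ j]mulr_natr.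
  rewrite (inj_eq (mulfI b0)) eqr_nat.
  by move/eqP.
have [p [pN pE]] := interpolation N (fun k => g (a + b *+ k)) x_inj.
exists p; split=> // k; apply/eqP; rewrite -subr_eq0; apply/eqP; move: k.
apply: (@recurrence_eq0 N) => [m|k kN]; last by rewrite pE ?subrr.
under eq_bigr do rewrite mulrDr mulrN mulrnDr addrA.
by rewrite sumrB g0 poly_fdiff_eq0 ?subrr.
Qed.

Lemma continuous_fdiff_eq0_poly N g : continuous g ->
  (forall a b, \sum_(0 <= k < N.+1)
    'C(N, k)%:R * (-1) ^+ (N - k) * g (a + b *+ k) = 0) ->
  exists p, (size p <= N)%N /\ forall t, g t = p.[t].
Proof.
move=> gc g0.
have lattice a b : b != 0 -> exists p, (size p <= N)%N /\
    forall k, g (a + b *+ k) = p.[a + b *+ k].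
  by move=> b0; apply: poly_on_progression => // m; exact: g0.
have [p [pN pE]] := lattice 0 1 (oner_neq0 _).
exists p; split=> //; suff -> : g = horner p by [].
apply: eq_continuous_rat => // [|r]; first exact: continuous_horner.
(* With [r = numq r / n], the progression of step [1 / n] starting at the
   integer [- M] contains both [r] and every natural number. *)
pose M := `|numq r|%N; pose n := `|denq r|%N.
have n_gt0 : (0 < n)%N by rewrite absz_gt0 denq_eq0.
have nR : n%:R != 0 :> R by rewrite pnatr_eq0 -lt0n.
have [q [qN qE]] := lattice (- M%:R) n%:R^-1 (invr_neq0 nR).
have -> : p = q.
  apply: poly_eq_on_nat => k.
  have := qE ((M + k) * n)%N.
  rewrite -[n%:R^-1 *+ _]mulr_natr natrM mulrCA mulVf // mulr1.
  rewrite natrD addKr => <-.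
  by have := pE k; rewrite add0r => ->.
have : exists k, ratr r = - M%:R + n%:R^-1 *+ k :> R.
  have k0 : 0 <= M%:Z * n%:Z + numq r.
    rewrite -lerBlDr sub0r (le_trans (ler_norm _)) // normrN abszE.
    by rewrite ler_peMr // lez_nat.
  exists `|(M%:Z * n%:Z + numq r)%R|%N.
  rewrite -[n%:R^-1 *+ _]mulr_natr -[(absz _)%:R]/((absz _)%:~R) gez0_abs //.
  rewrite intrD intrM mulrDr mulrCA.
  by rewrite mulVf // mulr1 addKr mulrC /ratr -absz_denq.
by case=> k ->; rewrite qE.
Qed.

End OneVariable.

(** * From lines to several variables *)

Definition poly_on_lines (R : realType) (d N : nat) (f : 'rV[R]_d -> R) :=
  forall x h : 'rV[R]_d, exists p : {poly R},
    (size p <= N)%N /\ forall t, f (x + t *: h) = p.[t].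

Section SeveralVariables.
Variables (R : realType) (d N : nat).
Implicit Types (f g : 'rV[R]_d -> R) (x y h : 'rV[R]_d) (p q : mpoly d R).

Lemma frechet_sol_poly_on_lines f : frechet_sol R d N f -> poly_on_lines N f.
Proof.
case=> fc f0 x h; apply: continuous_fdiff_eq0_poly => [t|a b].
  apply: (continuous_comp (f := fun t : R => x + t *: h)); last exact: fc.
  by apply: continuousD; [exact: cst_continuous|exact: scalel_continuous].
rewrite -[RHS](f0 (x + a *: h) (b *: h)) fdiff_iterE; apply: eq_bigr => k _.
by rewrite scalerDl addrA scalerMnl.
Qed.

Definition set_coord (i : 'I_d) (c : R) x : 'rV[R]_d :=
  \row_j if j == i then c else x ord0 j.

(** As [c] varies, [set_coord i c x] runs over a line, so that polynomiality on
    lines applies to it. *)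
Lemma set_coordE i c x : set_coord i c x = set_coord i 0 x + c *: delta_mx 0 i.
Proof.
apply/rowP => j; rewrite !mxE /=; case: eqP => _; first by rewrite add0r mulr1.
by rewrite mulr0 addr0.
Qed.

Lemma set_coord_id i x : set_coord i (x ord0 i) x = x.
Proof. by apply/rowP => j; rewrite mxE; case: eqP => [->|]. Qed.

Lemma poly_on_lines_set_coord i c f :
  poly_on_lines N f -> poly_on_lines N (f \o set_coord i c).
Proof.
move=> fl x h; have [p [pN pE]] := fl (set_coord i c x) (set_coord i 0 h).
exists p; split=> // t; rewrite -pE /=; congr f; apply/rowP => j; rewrite !mxE.
by case: eqP; rewrite ?mulr0 ?addr0.
Qed.

(** The list [s] contains the coordinates on which [f] may depend.  Lagrange
    interpolation in the coordinate [i] at the nodes [0, ..., N - 1] writes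
    [f] as a combination, with coefficients polynomial in [x_i], of the
    functions obtained by fixing [x_i] to a node; these depend on one
    coordinate less and are still polynomial on lines. *)
Lemma poly_on_lines_mpoly (s : seq 'I_d) f : (0 < N)%N ->
  poly_on_lines N f ->
  (forall x y, (forall i, i \in s -> x ord0 i = y ord0 i) -> f x = f y) ->
  exists p, forall x, f x = meval (fun i => x ord0 i) p.
Proof.
move=> N_gt0; elim: s f => [|i s IH] f fl fs.
  by exists (mpolyC d (f 0)) => x; rewrite mevalC; apply: fs.
have /choice[P PE] (j : 'I_N) : exists p, forall x,
    f (set_coord i j%:R x) = meval (fun i => x ord0 i) p.
  apply: (IH (f \o set_coord i j%:R)); first exact: poly_on_lines_set_coord.
  move=> x y xy; apply: fs => k; rewrite in_cons !mxE.
  by case: eqP => //= _; exact: xy.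
pose L (j : 'I_N) : {poly R} := tnth (N.-lagrange (fun k => k%:R)) j.
have node_inj : injective (fun k => k%:R : R).
  by move=> a b /eqP; rewrite eqr_nat => /eqP.
exists (\sum_(j < N)
  P j * \sum_(k < N) mpolyC d (L j)`_k * mpolyX R (mnm1 i) ^+ k).
move=> x; have [p [pN pE]] := fl (set_coord i 0 x) (delta_mx 0 i).
have {}pE c : f (set_coord i c x) = p.[c] by rewrite set_coordE pE.
rewrite -[in LHS](set_coord_id i x) pE (lagrange_gen N_gt0 node_inj pN).
rewrite horner_sum raddf_sum /=; apply: eq_bigr => j _.
rewrite hornerM hornerC -pE PE mevalM; congr (_ * _).
rewrite (@horner_coef_wide _ N) ?size_lagrange_ // raddf_sum.
by apply: eq_bigr => k _ /=; rewrite mevalM mevalC rmorphXn /= mevalXU.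
Qed.

(** A polynomial representing [f] is truncated to its monomials of degree less
    than [N].  This does not change its values, because the discarded
    homogeneous components are the higher coefficients of the restrictions of
    [f] to the lines through the origin. *)
Lemma poly_on_lines_polyfun f : (0 < N)%N ->
  poly_on_lines N f -> polyfun R d N.-1 f.
Proof.
move=> N_gt0 fl.
have [|p pE] := @poly_on_lines_mpoly (enum 'I_d) f N_gt0 fl.
  by move=> x y xy; congr f; apply/rowP => i; rewrite xy ?mem_enum.
exists (\sum_(m <- msupp p | (mdeg m < N)%N) mcoeff m p *: mpolyX R m); split.
  rewrite prednK //; apply: (leq_trans (msize_sum _ _ _)).
  apply/bigmax_leqP_seq => m _ mN.
  by rewrite (leq_trans (msizeZ_le _ _)) // msizeX.
apply/funext => x.
pose c m := mcoeff m p * \prod_i x ord0 i ^+ m i.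
(* [Q] is the restriction of [f] to the line spanned by [x], graded by the
   degree of the monomials. *)
pose Q : {poly R} := \sum_(m <- msupp p) c m *: 'X^(mdeg m).
have QE t : f (t *: x) = Q.[t].
  rewrite pE mevalE horner_sum; apply: eq_bigr => m _.
  rewrite hornerZ hornerXn -mulrA; congr (_ * _).
  rewrite mdegE -prodrXr mulrC -big_split /=; apply: eq_bigr => i _.
  by rewrite mxE exprMn.
have [q [qN qE]] := fl 0 x.
have QN : (size Q <= N)%N.
  suff -> : Q = q by [].
  by apply: poly_eq_on_nat => k; rewrite -QE -qE add0r.
rewrite -[x in LHS]scale1r QE (horner_coef_wide _ QN) raddf_sum /=.
under eq_bigr do rewrite expr1n mulr1 coef_sum.
rewrite exchange_big [RHS]big_mkcond /=; apply: eq_bigr => m _.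
under eq_bigr do rewrite coefZ coefXn.
rewrite -mulr_sumr mevalZ mevalX -/(c m).
case: ltnP => mN; last first.
  by rewrite big1 ?mulr0 // => k _; rewrite ltn_eqF // (leq_trans _ mN).
rewrite (bigD1 (Ordinal mN)) //= eqxx big1 ?addr0 ?mulr1 // => k.
by rewrite -val_eqE /= => /negPf ->.
Qed.

End SeveralVariables.

Theorem theorem3p1 (R : realType) (d N : nat) (hd : (1 <= d)%N)
    (hN : (1 <= N)%N) :
  [/\ forall (f : 'rV[R]_d -> R) (x h : 'rV[R]_d),
        fdiff_iter N h f x =
        \sum_(0 <= k < N.+1) 'C(N, k)%:R * (-1) ^+ (N - k) * f (x + h *+ k),
      frechet_sol R d N = frechet_mixed_sol R d N
    & frechet_sol R d N = polyfun R d N.-1].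
Proof.
have poly_mixed : polyfun R d N.-1 `<=` frechet_mixed_sol R d N.
  by rewrite -[X in frechet_mixed_sol _ _ X](prednK hN);
    exact: polyfun_frechet_mixed_sol.
have sol_poly : frechet_sol R d N `<=` polyfun R d N.-1.
  by move=> f /frechet_sol_poly_on_lines; exact: poly_on_lines_polyfun.
have mixed_sol := @frechet_mixed_sol_sub R d N.
split; first by move=> f x h; exact: fdiff_iterE.
  by apply/seteqP; split=> // f /sol_poly; exact: poly_mixed.
by apply/seteqP; split=> // f /poly_mixed; exact: mixed_sol.
Qed.
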